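(* Let $\boldsymbol A$ be an $n\times n$ complex interval matrix, and let $Y$, $Z(r)=rZ_0+r^2Z_1$ and $p_j(r)=(Y+Z(r))_j-r$ ($j=1,\dots,n$) be the uniform bounds and radii polynomials constructed from $\boldsymbol A$, an approximate eigenpair $(\bar\lambda,\bar{\mathrm v})$ of its center $\hat A$, and the matrix $R$, as described in the context. Suppose that $r>0$ is such that $p_j(r)<0$ for all $j=1,\dots,n$. Then for every $A\in\boldsymbol A$ there exists a unique $(\lambda,\mathrm v)\in\mathbb{C}\times\mathbb{C}^n$ such that $$|\lambda-\bar\lambda|\le r,\qquad |\mathrm v_j-\bar{\mathrm v}_j|\le r\ \ (j\neq k),\qquad \mathrm v_k=\bar{\mathrm v}_k,\qquad A\mathrm v=\lambda\mathrm v .$$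
   Context: A complex interval matrix $\boldsymbol A$ is an $n\times n$ array of complex intervals $\boldsymbol A_{i,j}=[\mathrm{Re}(\hat A_{i,j})\pm \mathrm{rad}^{(1)}_{i,j}]+\mathrm i[\mathrm{Im}(\hat A_{i,j})\pm \mathrm{rad}^{(2)}_{i,j}]$ with nonnegative radii; $\hat A\in\mathbb{C}^{n\times n}$ is its center. One writes $A\in\boldsymbol A$ if $A_{i,j}\in\boldsymbol A_{i,j}$ for all $i,j$. Interval arithmetic extends the basic operations $\circ\in\{+,-,\cdot,/\}$ (and absolute values) to interval quantities so that $P\in\boldsymbol P$, $Q\in\boldsymbol Q$ imply $P\circ Q\in\boldsymbol P\circ\boldsymbol Q$. Let $(\bar\lambda,\bar{\mathrm v})\in\mathbb{C}\times\mathbb{C}^n$ be an approximate eigenpair of $\hat A$ (no quantitative closeness is prescribed), let $k$ be an index for which $\bar{\mathrm v}_k$ is a component of $\bar{\mathrm v}$ of largest modulus, and let $\bar x=(\bar\lambda,\bar{\mathrm v}_1,\dots,\bar{\mathrm v}_{k-1},\bar{\mathrm v}_{k+1},\dots,\bar{\mathrm v}_n)\in\mathbb{C}^n$. For $A\in\mathbb{C}^{n\times n}$ and $x=(\lambda,\mathrm v_1,\dots,\mathrm v_{k-1},\mathrm v_{k+1},\dots,\mathrm v_n)\in\mathbb{C}^n$ put $$f_A(x)=A\mathrm w-\lambda\mathrm w,\qquad \mathrm w=(\mathrm v_1,\dots,\mathrm v_{k-1},\bar{\mathrm v}_k,\mathrm v_{k+1},\dots,\mathrm v_n)^{T},$$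 whose Jacobian at $\bar x$ is $Df_A(\bar x)=[\,-\bar{\mathrm v}\mid (A-\bar\lambda I_n)_{\hat k}\,]$, where $(M)_{\hat k}$ is $M$ with the $k$-th column deleted. Let $\boldsymbol f(\bar x)$ and $\boldsymbol{Df}(\bar x)$ be the interval vector and interval matrix obtained by replacing $A$ by $\boldsymbol A$ in these formulas and evaluating in interval arithmetic; in particular $f_A(\bar x)\in\boldsymbol f(\bar x)$ and $Df_A(\bar x)\in\boldsymbol{Df}(\bar x)$ for all $A\in\boldsymbol A$. Let $R\in\mathbb{C}^{n\times n}$ be a fixed matrix which is a numerical inverse of the center of $\boldsymbol{Df}(\bar x)$ (no quantitative closeness is prescribed). With $|\cdot|$ the componentwise absolute value, $\mathbf 1_n$ the all-ones column vector of length $n$, and $\hat{\mathbf 1}_n$ the same vector with $0$ in the $k$-th component, define componentwise, using interval arithmetic evaluations, $$Y=\sup|R\,\boldsymbol f(\bar x)|,\qquad Z_0=\sup\big(|I_n-R\,\boldsymbol{Df}(\bar x)|\,\mathbf 1_n\big),\qquad Z_1=\sup\big(2|R|\,\hat{\mathbf 1}_n\big),$$ where $\sup$ of an interval vector is the vector of upper endpoints. In particular, by inclusion, $|Rf_A(\bar x)|\le Y$ and $|I_n-R\,Df_A(\bar x)|\mathbf 1_n\le Z_0$ componentwise for all $A\in\boldsymbol A$, and $2|R|\hat{\mathbf 1}_n\le Z_1$. *)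

(* Defs.v *)
From HB Require Import structures.
From mathcomp Require Import all_boot all_order all_algebra.
From mathcomp Require Import reals complex.
From mathcomp Require Import ring.

Set Implicit Arguments.
Unset Strict Implicit.
Unset Printing Implicit Defensive.

Import Order.TTheory GRing.Theory Num.Theory.

Local Open Scope ring_scope.
Local Open Scope complex_scope.

Record ritv (R : realType) := RItv {
  rmid : R;
  rrad : R;
  rrad_ge0 : 0 <= rrad
}.

Record citv (R : realType) := CItv {
  cre : ritv R;
  cim : ritv R
}.

Section Intervals.
Context {R : realType}.

Definition rsup (P : ritv R) : R := rmid P + rrad P.

Definition rmem (x : R) (P : ritv R) : bool :=
  x \in `[rmid P - rrad P, rmid P + rrad P].

Definition cmem (z : R[i]) (P : citv R) : bool :=
  rmem (complex.Re z) (cre P) && rmem (complex.Im z) (cim P).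

Definition rpt (x : R) : ritv R := RItv x (lexx 0).
Definition cpt (z : R[i]) : citv R :=
  CItv (rpt (complex.Re z)) (rpt (complex.Im z)).

Definition mxmem m n (A : 'M[R[i]]_(m, n)) (B : 'M[citv R]_(m, n)) : Prop :=
  forall i j, cmem (A i j) (B i j).

End Intervals.

(* An interval arithmetic is any choice of operations satisfying the inclusion
   property: exact rectangular arithmetic, outward-rounded arithmetic, etc.
   Only the operations occurring in the bounds below are recorded; in
   particular no division is needed. *)
Record interval_arith (R : realType) := IntervalArith {
  radd : ritv R -> ritv R -> ritv R;
  rmul : ritv R -> ritv R -> ritv R;
  cadd : citv R -> citv R -> citv R;
  csub : citv R -> citv R -> citv R;
  cmul : citv R -> citv R -> citv R;
  cabs : citv R -> ritv R;
  raddP : forall (P Q : ritv R) (x y : R),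
    rmem x P -> rmem y Q -> rmem (x + y) (radd P Q);
  rmulP : forall (P Q : ritv R) (x y : R),
    rmem x P -> rmem y Q -> rmem (x * y) (rmul P Q);
  caddP : forall (P Q : citv R) (z w : R[i]),
    cmem z P -> cmem w Q -> cmem (z + w) (cadd P Q);
  csubP : forall (P Q : citv R) (z w : R[i]),
    cmem z P -> cmem w Q -> cmem (z - w) (csub P Q);
  cmulP : forall (P Q : citv R) (z w : R[i]),
    cmem z P -> cmem w Q -> cmem (z * w) (cmul P Q);
  (* [`|z|] lives in [R[i]]; its real part is the modulus as an element of [R] *)
  cabsP : forall (P : citv R) (z : R[i]),
    cmem z P -> rmem (complex.Re `|z|) (cabs P)
}.

Section MatrixArith.
Context {R : realType} (IA : interval_arith R).

Definition cptmx m n (A : 'M[R[i]]_(m, n)) : 'M[citv R]_(m, n) := map_mx cpt A.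
Definition rptmx m n (A : 'M[R]_(m, n)) : 'M[ritv R]_(m, n) := map_mx rpt A.

Definition csubmx m n (A B : 'M[citv R]_(m, n)) : 'M[citv R]_(m, n) :=
  map2_mx (csub IA) A B.

Definition cmulmx m n p (A : 'M[citv R]_(m, n)) (B : 'M[citv R]_(n, p)) :
    'M[citv R]_(m, p) :=
  \matrix_(i, j) \big[cadd IA/cpt 0]_(l < n) cmul IA (A i l) (B l j).

Definition rmulmx m n p (A : 'M[ritv R]_(m, n)) (B : 'M[ritv R]_(n, p)) :
    'M[ritv R]_(m, p) :=
  \matrix_(i, j) \big[radd IA/rpt 0]_(l < n) rmul IA (A i l) (B l j).

Definition rscalemx m n (a : ritv R) (A : 'M[ritv R]_(m, n)) :
    'M[ritv R]_(m, n) :=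
  map_mx (rmul IA a) A.

Definition cscalemx m n (a : citv R) (A : 'M[citv R]_(m, n)) :
    'M[citv R]_(m, n) :=
  map_mx (cmul IA a) A.

Definition cabsmx m n (A : 'M[citv R]_(m, n)) : 'M[ritv R]_(m, n) :=
  map_mx (cabs IA) A.

Definition rsupmx m n (A : 'M[ritv R]_(m, n)) : 'M[R]_(m, n) :=
  map_mx rsup A.

End MatrixArith.

(* The dimension is [n.+1].  The unknown [x = (lambda, v_j (j <> k))] is ordered
   with [lambda] first, so that the Jacobian [-v | (A - lambda I) without
   column k] has shape [(n.+1, 1 + n)], convertible to a square matrix. *)
Section Bounds.
Context {R : realType} (IA : interval_arith R) (n : nat).
Variables (bA : 'M[citv R]_n.+1) (lam : R[i]) (v : 'cV[R[i]]_n.+1).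
Variables (k : 'I_n.+1) (Rm : 'M[R[i]]_n.+1).

(* At [x = (lam, v_j (j <> k))] the completed vector [w] is [v] itself. *)
Definition f_itv : 'cV[citv R]_n.+1 :=
  csubmx IA (cmulmx IA bA (cptmx v)) (cscalemx IA (cpt lam) (cptmx v)).

Definition Df_itv : 'M[citv R]_n.+1 :=
  row_mx (cptmx (- v)) (col' k (csubmx IA bA (cptmx (lam%:M)))).

Definition ones : 'cV[R]_n.+1 := const_mx 1.
Definition ones_hat : 'cV[R]_n.+1 := \col_j (if j == k then 0 else 1).

Definition Ybound : 'cV[R]_n.+1 :=
  rsupmx (cabsmx IA (cmulmx IA (cptmx Rm) f_itv)).

Definition Z0bound : 'cV[R]_n.+1 :=
  rsupmx (rmulmx IA
    (cabsmx IA (csubmx IA (cptmx 1%:M) (cmulmx IA (cptmx Rm) Df_itv)))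
    (rptmx ones)).

Definition Z1bound : 'cV[R]_n.+1 :=
  rsupmx (rmulmx IA
    (rscalemx IA (rpt 2) (cabsmx IA (cptmx Rm)))
    (rptmx ones_hat)).

Definition Zbound (r : R) : 'cV[R]_n.+1 :=
  r *: Z0bound + r ^+ 2 *: Z1bound.

Definition radii_poly (j : 'I_n.+1) (r : R) : R :=
  (Ybound + Zbound r) j 0 - r.

End Bounds.

(* Midpoint-radius arithmetic satisfies the inclusion property, so
   [interval_arith R] is inhabited. *)
Section MidRad.
Context {R : realType}.

Lemma rmemE (x : R) (P : ritv R) : rmem x P = (`|x - rmid P| <= rrad P).
Proof. by rewrite /rmem in_itv /= -ler_distl. Qed.

Definition mr_add (P Q : ritv R) : ritv R :=
  RItv (rmid P + rmid Q) (addr_ge0 (rrad_ge0 P) (rrad_ge0 Q)).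

Definition mr_sub (P Q : ritv R) : ritv R :=
  RItv (rmid P - rmid Q) (addr_ge0 (rrad_ge0 P) (rrad_ge0 Q)).

Lemma mr_mul_ge0 (P Q : ritv R) :
  0 <= rrad P * rrad Q + (`|rmid P| * rrad Q + rrad P * `|rmid Q|).
Proof. by rewrite !addr_ge0 // mulr_ge0 // rrad_ge0. Qed.

Definition mr_mul (P Q : ritv R) : ritv R :=
  RItv (rmid P * rmid Q) (mr_mul_ge0 P Q).

Definition mr_cadd (P Q : citv R) : citv R :=
  CItv (mr_add (cre P) (cre Q)) (mr_add (cim P) (cim Q)).

Definition mr_csub (P Q : citv R) : citv R :=
  CItv (mr_sub (cre P) (cre Q)) (mr_sub (cim P) (cim Q)).

Definition mr_cmul (P Q : citv R) : citv R :=
  CItv (mr_sub (mr_mul (cre P) (cre Q)) (mr_mul (cim P) (cim Q)))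
       (mr_add (mr_mul (cre P) (cim Q)) (mr_mul (cim P) (cre Q))).

Definition mr_cabs (P : citv R) : ritv R :=
  RItv (complex.Re `|rmid (cre P) +i* rmid (cim P)|)
       (addr_ge0 (rrad_ge0 (cre P)) (rrad_ge0 (cim P))).

Lemma mr_addP (P Q : ritv R) (x y : R) :
  rmem x P -> rmem y Q -> rmem (x + y) (mr_add P Q).
Proof.
rewrite !rmemE /= => xP yQ; rewrite opprD addrACA.
exact: le_trans (ler_normD _ _) (lerD xP yQ).
Qed.

Lemma mr_subP (P Q : ritv R) (x y : R) :
  rmem x P -> rmem y Q -> rmem (x - y) (mr_sub P Q).
Proof.
rewrite !rmemE /= => xP yQ.
have -> : x - y - (rmid P - rmid Q) = (x - rmid P) - (y - rmid Q) by ring.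
exact: le_trans (ler_normB _ _) (lerD xP yQ).
Qed.

Lemma mr_mulP (P Q : ritv R) (x y : R) :
  rmem x P -> rmem y Q -> rmem (x * y) (mr_mul P Q).
Proof.
rewrite !rmemE /= => xP yQ.
have -> : x * y - rmid P * rmid Q = (x - rmid P) * (y - rmid Q)
    + (rmid P * (y - rmid Q) + (x - rmid P) * rmid Q) by ring.
apply: le_trans (ler_normD _ _) _; rewrite lerD //.
  by rewrite normrM ler_pM.
apply: le_trans (ler_normD _ _) _; rewrite !normrM lerD //.
  by rewrite ler_wpM2l.
by rewrite ler_wpM2r.
Qed.

Lemma mr_caddP (P Q : citv R) (z w : R[i]) :
  cmem z P -> cmem w Q -> cmem (z + w) (mr_cadd P Q).
Proof.
by case: z w => [a b] [c d] /andP[? ?] /andP[? ?]; apply/andP; split;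
  apply: mr_addP.
Qed.

Lemma mr_csubP (P Q : citv R) (z w : R[i]) :
  cmem z P -> cmem w Q -> cmem (z - w) (mr_csub P Q).
Proof.
by case: z w => [a b] [c d] /andP[? ?] /andP[? ?]; apply/andP; split;
  apply: mr_subP.
Qed.

Lemma mr_cmulP (P Q : citv R) (z w : R[i]) :
  cmem z P -> cmem w Q -> cmem (z * w) (mr_cmul P Q).
Proof.
case: z w => [a b] [c d] /andP[/= ? ?] /andP[/= ? ?]; apply/andP; split => /=.
  by apply: mr_subP; apply: mr_mulP.
by apply: mr_addP; apply: mr_mulP.
Qed.

Lemma Re_norm_le (z : R[i]) :
  complex.Re `|z| <= `|complex.Re z| + `|complex.Im z|.
Proof.
have [rz iz] := (normr_ge0 (complex.Re z), normr_ge0 (complex.Im z)).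
rewrite normc_def /= -[leRHS]ger0_norm ?addr_ge0 // -sqrtr_sqr ler_wsqrtr //.
rewrite sqrrD !real_normK ?num_real // addrAC lerDl.
by rewrite mulrn_wge0 // mulr_ge0.
Qed.

Lemma mr_cabsP (P : citv R) (z : R[i]) :
  cmem z P -> rmem (complex.Re `|z|) (mr_cabs P).
Proof.
case/andP; rewrite !rmemE => aP bP.
apply: le_trans (lerD aP bP).
set c : R[i] := rmid (cre P) +i* rmid (cim P).
have -> : rmid (mr_cabs P) = complex.Re `|c| by [].
have -> : complex.Re z - rmid (cre P) = complex.Re (z - c).
  by case: (z).
have -> : complex.Im z - rmid (cim P) = complex.Im (z - c).
  by case: (z).
apply: le_trans (Re_norm_le _).
have := ler_dist_dist z c; rewrite !normc_def -rmorphB /=.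
by rewrite expr0n /= addr0 sqrtr_sqr lecR.
Qed.

Definition midrad_arith : interval_arith R :=
  IntervalArith mr_addP mr_mulP mr_caddP mr_csubP mr_cmulP mr_cabsP.

End MidRad.

(* Main.v *)
(** Shift the unknown to [x = xbar + h].  Since [f_A] is quadratic,
    [f_A (xbar + h) = f_A xbar + Df_A xbar h - h_0 e(h)], where [h_0] is the
    eigenvalue part of [h] and [e(h)] its eigenvector part completed by [0] at
    [k].  Hence the Newton-like map [T h = h - R f_A (xbar + h)] satisfies
    [T h - T g = (I - R Df) (h - g) + R (h_0 e(h) - g_0 e(g))], which on the
    ball of radius [r] is bounded in component [j] by [(Z0 + r Z1)_j] times the
    distance of [h] and [g]; moreover [|T 0| <= Y].  Negative radii polynomials
    say that [T] is a contraction of the ball into itself.  They also give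
    [Z0 < 1], so [R Df], hence [R], is invertible, and the fixed points of [T]
    are exactly the zeros of [f_A]. *)
Require Import Defs.
From HB Require Import structures.
From mathcomp Require Import all_boot all_order all_algebra.
From mathcomp Require Import reals complex.
From mathcomp Require Import classical_sets topology normedtype sequences.
From mathcomp Require Import ring lra.

Import Order.TTheory GRing.Theory Num.Theory.
Import numFieldNormedType.Exports.
Local Open Scope ring_scope.
Local Open Scope complex_scope.

(** * Limits of geometrically convergent sequences in [R] and [R[i]] *)

Section Geometric.
Context {R : realType}.
Implicit Types (x y q K : R) (z : R[i]).

Lemma le_of_le_add_geometric q K x y : 0 <= q < 1 ->
  (forall m, x <= y + K * q ^+ m) -> x <= y.
Proof.
move=> /andP[q0 q1] H.
have q1' : `|q| < 1 by rewrite ger0_norm.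
have cvK := cvg_geometric K q1'.
rewrite -subr_le0 -(cvg_lim (@Rhausdorff R) cvK) //.
apply: limr_ge; first by apply/cvg_ex; exists 0.
by apply: nearW => m; rewrite lerBlDl /=.
Qed.

Lemma normc_le_of_le_add_geometric q K y z : 0 <= q < 1 ->
  (forall m, `|z| <= (y + K * q ^+ m)%:C) -> `|z| <= y%:C.
Proof.
rewrite normc_def => q01 H; rewrite lecR.
by apply: le_of_le_add_geometric q01 _ => m; rewrite -lecR.
Qed.

Lemma normc_eq0_of_le_geometric q K z : 0 <= q < 1 ->
  (forall m, `|z| <= (K * q ^+ m)%:C) -> z = 0.
Proof.
move=> q01 H; apply/eqP; rewrite -normr_le0.
have : `|z| <= 0%:C; last by rewrite rmorph0.
by apply: normc_le_of_le_add_geometric q01 _ => m; rewrite add0r.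
Qed.

(* The intervals of radius [D / (1 - q) * q ^+ m] around [a m] are nested. *)
Lemma geometric_limit q D (a : nat -> R) : 0 <= q < 1 ->
  (forall m, `|a m.+1 - a m| <= q ^+ m * D) ->
  exists l, forall m, `|a m - l| <= D / (1 - q) * q ^+ m.
Proof.
move=> /andP[q0 q1] H.
pose e m := D / (1 - q) * q ^+ m.
have q1' : 1 - q != 0 by rewrite subr_eq0 eq_sym lt_eqF.
have eS m : e m = e m.+1 + q ^+ m * D.
  by rewrite /e exprS; field.
have D0 : 0 <= D by have := le_trans (normr_ge0 _) (H 0%N); rewrite mul1r.
have e0 m : 0 <= e m by rewrite mulr_ge0 ?exprn_ge0 // divr_ge0 // subr_ge0 ltW.
have lowS m : a m - e m <= a m.+1 - e m.+1.
  by have := H m; rewrite ler_norml (eS m) => /andP[? _]; lra.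
have uppS m : a m.+1 + e m.+1 <= a m + e m.
  by have := H m; rewrite ler_norml (eS m) => /andP[_ ?]; lra.
have low m p : (m <= p)%N -> a m - e m <= a p - e p.
  apply: (homo_leq (f := fun i => a i - e i) (r := fun x y => x <= y)) => //.
  by move=> ? ? ?; exact: le_trans.
have upp m p : (m <= p)%N -> a p + e p <= a m + e m.
  apply: (homo_leq (f := fun i => a i + e i) (r := fun x y => y <= x)) => //.
  by move=> x y z yx zy; exact: le_trans zy yx.
have lu m p : a m - e m <= a p + e p.
  have [le|/ltnW le] := leqP m p.
    by have := low _ _ le; have := e0 p; lra.
  by have := upp _ _ le; have := e0 m; lra.
pose E := range (fun m => a m - e m).
have ubE p : ubound E (a p + e p) by move=> _ [m _ <-]; exact: lu.
(* The supremum of the left endpoints lies in every interval, since each right endpoint is an upper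
   bound of [E]. *)
exists (sup E) => m; rewrite -/(e m) distrC ler_distl; apply/andP; split.
  by apply: ub_le_sup; [exists (a 0%N + e 0%N) | exists m].
by apply: ge_sup => //; exists (a 0%N - e 0%N), 0%N.
Qed.

(** Real and imaginary parts converge separately; the factor 2 comes from bounding a modulus by the
    sum of their absolute values. *)
Lemma geometric_limitC q D (u : nat -> R[i]) : 0 <= q < 1 ->
  (forall m, `|u m.+1 - u m| <= (q ^+ m * D)%:C) ->
  exists l, forall m, `|u m - l| <= (2 * (D / (1 - q)) * q ^+ m)%:C.
Proof.
move=> q01 H.
have [m|l1 H1] := @geometric_limit q D (fun m => complex.Re (u m)) q01.
  rewrite -lecR; apply: le_trans (H m).
  by apply: le_trans (normc_ge_Re _); rewrite lecR raddfB.
have [m|l2 H2] := @geometric_limit q D (fun m => complex.Im (u m)) q01.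
  rewrite -lecR; apply: le_trans (H m).
  (* Multiplication by ['i] preserves the modulus and turns the imaginary part into minus the real
     part. *)
  have ImRe z : `|complex.Im z|%:C <= `|z|.
    have -> : `|z| = `|z * 'i|.
      by rewrite normrM [`|'i|]normc_def /= expr0n expr1n add0r sqrtr1 mulr1.
    by apply: le_trans (normc_ge_Re _); rewrite ReiNIm normrN.
  by apply: le_trans (ImRe _); rewrite lecR raddfB.
exists (l1 +i* l2) => m; set z := _ - _.
rewrite -[leLHS]RRe_real ?normr_real //.
rewrite lecR; apply: le_trans (Re_norm_le z) _.
have := H1 m; have := H2 m; rewrite /z; case: (u m) => x y /=; lra.
Qed.

End Geometric.

(** * Banach's fixed point principle in the maximum norm *)

Section Contraction.
Context {R : realType} {m : nat}.
Implicit Types (h g : 'cV[R[i]]_m) (d q r : R).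

Definition in_cball d h := forall i, `|h i 0| <= d%:C.

(** Iteration confines [h] to balls of radius [q ^+ p * d], which shrink to 0. This serves both
    uniqueness of fixed points and triviality of a kernel. *)
Lemma contracted_eq0 q d h : 0 <= q < 1 -> in_cball d h ->
  (forall e, in_cball e h -> in_cball (q * e) h) -> h = 0.
Proof.
move=> q01 hd H.
have hm p : in_cball (q ^+ p * d) h.
  elim: p => [|p IH]; first by rewrite mul1r.
  by rewrite exprS -mulrA; apply: H.
apply/matrixP => i j; rewrite ord1 [RHS]mxE.
apply: (normc_eq0_of_le_geometric q d _ q01) => p.
by rewrite mulrC; exact: hm.
Qed.

(** Picard iteration from 0: successive differences decay like [q ^+ p * r], so every component
    converges geometrically. *)
Lemma contraction_fixpoint (T : 'cV[R[i]]_m -> 'cV[R[i]]_m) q r :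
    0 <= q < 1 -> 0 <= r ->
    (forall h, in_cball r h -> in_cball r (T h)) ->
    (forall h g d, in_cball r h -> in_cball r g -> in_cball d (h - g) ->
       in_cball (q * d) (T h - T g)) ->
  exists2 h, in_cball r h & T h = h.
Proof.
move=> q01 r0 Tr Tq.
pose u p := iter p T 0.
have ur p : in_cball r (u p).
  elim: p => [|p IH]; last exact: Tr.
  by move=> i; rewrite mxE normr0 ler0c.
have uq p : in_cball (q ^+ p * r) (u p.+1 - u p).
  elim: p => [|p IH]; first by rewrite mul1r subr0; exact: (ur 1%N).
  by rewrite exprS -mulrA; exact: (Tq _ _ _ (ur _) (ur _) IH).
pose K := 2 * (r / (1 - q)).
have /fin_all_exists[l ul] : forall i, exists l, forall p,
    `|u p i 0 - l| <= (K * q ^+ p)%:C.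
  by move=> i; apply: geometric_limitC => // p; have := uq p i; rewrite !mxE.
pose h := \col_i l i.
have uh p : in_cball (K * q ^+ p) (u p - h).
  by move=> i; rewrite !mxE.
have hr : in_cball r h.
  move=> i; apply: (normc_le_of_le_add_geometric _ K _ _ q01) => p.
  rewrite -[h i 0](subrK (u p i 0)) addrC; apply: le_trans (ler_normD _ _) _.
  rewrite raddfD lerD //; first exact: ur.
  by have := uh p i; rewrite !mxE distrC.
exists h => //; apply/subr0_eq/matrixP => i j; rewrite ord1 [RHS]mxE.
(* Since [T (u p)] is [u p.+1], inserting it splits [T h - h] into two terms, each at most
   [K * q ^+ p.+1]. *)
apply: (normc_eq0_of_le_geometric q (K * q + K * q) _ q01) => p.
have -> : T h - h = (T h - T (u p)) + (u p.+1 - h) by rewrite addrA subrK.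
rewrite mxE; apply: le_trans (ler_normD _ _) _.
rewrite mulrDl raddfD -!(mulrA K) -exprS lerD //; last exact: uh.
have := Tq h (u p) (K * q ^+ p) hr (ur p).
rewrite -opprB mulrCA -exprS; apply => i'; have := uh p i'.
by rewrite !mxE normrN.
Qed.

End Contraction.

(** The weight [w] lets one row-sum estimate serve both the linear part ([w] all ones) and the
    quadratic part ([w] twice [ones_hat]). *)
Lemma le_mulmx_col {R : realType} {p m : nat} (M : 'M[R[i]]_(p, m))
    (h : 'cV[R[i]]_m) (w : 'cV[R]_m) (c d : R) (j : 'I_p) :
  0 <= d -> \sum_l complex.Re `|M j l| * w l 0 <= c ->
  (forall l, `|h l 0| <= (w l 0 * d)%:C) -> `|(M *m h) j 0| <= (c * d)%:C.
Proof.
move=> d0 cM hw; rewrite mxE; apply: le_trans (ler_norm_sum _ _ _) _.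
apply: (@le_trans _ _ ((\sum_l complex.Re `|M j l| * w l 0) * d)%:C);
  last by rewrite lecR ler_wpM2r.
rewrite mulr_suml rmorph_sum /=; apply: ler_sum => l _.
rewrite normrM -mulrA [leRHS]rmorphM /=.
have -> : (complex.Re `|M j l|)%:C = `|M j l| by rewrite RRe_real // normr_real.
by rewrite ler_wpM2l.
Qed.

(** * From componentwise bounds to a contraction of the ball *)

Section RadiiPolynomial.
Context {R : realType} {m : nat}.
Implicit Types (h g : 'cV[R[i]]_m) (d r : R) (c : 'I_m -> R).

(** A maximum of finitely many numbers below 1 is below 1; starting it at 0 keeps [q]
    nonnegative. *)
Lemma bounded_factor c : (forall j, c j < 1) ->
  exists2 q, 0 <= q < 1 & forall j, c j <= q.
Proof.
move=> c1; exists (\big[Order.max/0]_j c j) => [|j]; last first.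
  exact: (le_bigmax 0 c j).
apply/andP; split; first exact: bigmax_ge_id.
by apply: bigmax_lt.
Qed.

Lemma in_cball_ge0 d h : (0 < m)%N -> in_cball d h -> 0 <= d.
Proof.
by move=> m0 /(_ (Ordinal m0)) hd; rewrite -ler0c; apply: le_trans hd.
Qed.

Section Factor.
Variables (c : 'I_m -> R) (r : R) (T : 'cV[R[i]]_m -> 'cV[R[i]]_m).
Hypothesis c1 : forall j, c j < 1.
Hypothesis Tc : forall h g d, in_cball r h -> in_cball r g ->
  in_cball d (h - g) -> forall j, `|(T h - T g) j 0| <= (c j * d)%:C.

Lemma componentwise_contraction : exists2 q, 0 <= q < 1 &
  forall h g d, in_cball r h -> in_cball r g ->
    in_cball d (h - g) -> in_cball (q * d) (T h - T g).
Proof.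
have [q q01 cq] := bounded_factor _ c1.
exists q => // h g d hr gr hg j; apply: le_trans (Tc _ _ _ hr gr hg j) _.
rewrite lecR ler_wpM2r //; apply: in_cball_ge0 hg.
exact: leq_ltn_trans (ltn_ord j).
Qed.

Lemma componentwise_fixpoint_unique h g :
  in_cball r h -> in_cball r g -> T h = h -> T g = g -> h = g.
Proof.
move=> hr gr Th Tg; have [q q01 Tq] := componentwise_contraction.
apply: subr0_eq; apply: (contracted_eq0 q (r + r)) => //.
  move=> i; rewrite !mxE; apply: le_trans (ler_normB _ _) _.
  by rewrite raddfD lerD.
by move=> e /(Tq _ _ _ hr gr); rewrite Th Tg.
Qed.

(** The ball is invariant because [T h = T 0 + (T h - T 0)] has component [j] at most
    [Y j + c j * r]. *)
Lemma radii_fixpoint (Y : 'I_m -> R) : 0 < r ->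
  (forall j, `|T 0 j 0| <= (Y j)%:C) -> (forall j, Y j + c j * r <= r) ->
  exists2 h, in_cball r h & T h = h.
Proof.
move=> r0 TY Yr; have [q q01 Tq] := componentwise_contraction.
have in0 : in_cball r (0 : 'cV[R[i]]_m).
  by move=> j; rewrite mxE normr0 ler0c ltW.
apply: (contraction_fixpoint T q r q01 (ltW r0)) => // h hr j.
have -> : T h = T 0 + (T h - T 0) by rewrite addrC subrK.
rewrite mxE; apply: le_trans (ler_normD _ _) _.
apply: (@le_trans _ _ (Y j + c j * r)%:C); last by rewrite lecR.
by rewrite raddfD lerD // Tc // subr0.
Qed.

End Factor.

(** A kernel vector equals its image under [1%:M - M], whose row sums are below 1, so it is
    contracted to 0. *)
Lemma sub1_small_ker0 (M : 'M[R[i]]_m) c : (forall j, c j < 1) ->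
  (forall j, \sum_l complex.Re `|(1%:M - M) j l| *
     (const_mx 1 : 'cV[R]_m) l 0 <= c j) ->
  forall h, M *m h = 0 -> h = 0.
Proof.
move=> c1 Mc h Mh; have [q q01 cq] := bounded_factor _ c1.
pose d := \sum_i complex.Re `|h i 0|.
apply: (contracted_eq0 q d) => //.
  move=> i; rewrite -[leLHS]RRe_real ?normr_real // lecR /d (bigD1 i) // lerDl.
  by apply: sumr_ge0 => j _; rewrite normc_def /= sqrtr_ge0.
move=> e he j; have e0 : 0 <= e.
  by apply: in_cball_ge0 he; exact: leq_ltn_trans (ltn_ord j).
have -> : h = (1%:M - M) *m h by rewrite mulmxBl mul1mx Mh subr0.
apply: (@le_trans _ _ (c j * e)%:C); last by rewrite lecR ler_wpM2r.
by apply: le_mulmx_col e0 (Mc j) _ => l; rewrite mxE mul1r.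
Qed.

End RadiiPolynomial.

Lemma ker0_unitmx {F : fieldType} {m : nat} (M : 'M[F]_m) :
  (forall h : 'cV_m, M *m h = 0 -> h = 0) -> M \in unitmx.
Proof.
(* [det0P] produces a row vector, so the kernel condition is used on the transpose. *)
move=> M0; rewrite -unitmx_tr unitmxE unitfE; apply/det0P => -[v v0].
move=> /(congr1 trmx); rewrite trmx_mul trmxK trmx0 => /M0 vT0.
by move: v0; rewrite -[v]trmxK vT0 trmx0 eqxx.
Qed.

(** * Inclusion property for interval matrices *)

Section Inclusion.
Context {R : realType} (IA : interval_arith R).

Lemma rmem_rpt (x : R) : rmem x (rpt x).
Proof. by rewrite rmemE /= subrr normr0. Qed.

Lemma cmem_cpt (z : R[i]) : cmem z (cpt z).
Proof. by rewrite /cmem !rmem_rpt. Qed.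

Lemma rmem_le_rsup (x : R) (P : ritv R) : rmem x P -> x <= rsup P.
Proof. by rewrite /rmem in_itv /= => /andP[]. Qed.

Lemma mxmem_cptmx m n (A : 'M[R[i]]_(m, n)) : mxmem A (cptmx A).
Proof. by move=> i j; rewrite mxE; exact: cmem_cpt. Qed.

Lemma mxmem_csubmx m n (A B : 'M[R[i]]_(m, n)) bA bB :
  mxmem A bA -> mxmem B bB -> mxmem (A - B) (csubmx IA bA bB).
Proof. by move=> hA hB i j; rewrite !mxE; apply: csubP. Qed.

Lemma mxmem_cscalemx m n (a : R[i]) (A : 'M[R[i]]_(m, n)) ba bA :
  cmem a ba -> mxmem A bA -> mxmem (a *: A) (cscalemx IA ba bA).
Proof. by move=> ha hA i j; rewrite !mxE; apply: cmulP. Qed.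

Lemma mxmem_cmulmx m n p (A : 'M[R[i]]_(m, n)) (B : 'M[R[i]]_(n, p)) bA bB :
  mxmem A bA -> mxmem B bB -> mxmem (A *m B) (cmulmx IA bA bB).
Proof.
move=> hA hB i j; rewrite !mxE.
apply: (big_ind2 (fun z P => cmem z P)); first exact: cmem_cpt.
  by move=> z P w Q; exact: caddP.
by move=> l _; apply: cmulP.
Qed.

Lemma mxmem_row_mx m n p (A : 'M[R[i]]_(m, n)) (B : 'M[R[i]]_(m, p)) bA bB :
  mxmem A bA -> mxmem B bB -> mxmem (row_mx A B) (row_mx bA bB).
Proof.
move=> hA hB i j; case: (split_ordP j) => l ->; first by rewrite !row_mxEl.
by rewrite !row_mxEr.
Qed.

Lemma mxmem_col' m n (k : 'I_n) (A : 'M[R[i]]_(m, n)) bA :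
  mxmem A bA -> mxmem (col' k A) (col' k bA).
Proof. by move=> hA i j; rewrite !mxE. Qed.

Lemma le_rmulmx_rptmx m n (A : 'M[R]_(m, n)) (bA : 'M[ritv R]_(m, n))
    (w : 'cV[R]_n) j :
  (forall i l, rmem (A i l) (bA i l)) ->
  \sum_l A j l * w l 0 <= rsupmx (rmulmx IA bA (rptmx w)) j 0.
Proof.
move=> hA; rewrite !mxE; apply: rmem_le_rsup.
apply: (big_ind2 (fun x P => rmem x P)); first exact: rmem_rpt.
  by move=> x P y Q; exact: raddP.
by move=> l _; apply: rmulP => //; rewrite mxE; exact: rmem_rpt.
Qed.

End Inclusion.

(** * The eigenpair equation and its Newton-like map *)

Section Eigenpair.
Context {R : realType} {n : nat}.
Variables (A : 'M[R[i]]_n.+1) (lam : R[i]) (v : 'cV[R[i]]_n.+1) (k : 'I_n.+1).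
Implicit Types h g : 'cV[R[i]]_n.+1.

Definition Df_mx : 'M[R[i]]_n.+1 := row_mx (- v) (col' k (A - lam%:M)).

(* The unknown carries the eigenvalue in entry [ord0], so its entry
   [lift ord0 l] belongs to entry [lift k l] of the eigenvector. *)
Definition eigenvec_part h : 'cV[R[i]]_n.+1 :=
  \col_j if unlift k j is Some l then h (lift ord0 l) 0 else 0.

Definition eigenpair_shift h : R[i] * 'cV[R[i]]_n.+1 :=
  (lam + h ord0 0, v + eigenvec_part h).

Lemma eigenvec_partB h g :
  eigenvec_part (h - g) = eigenvec_part h - eigenvec_part g.
Proof.
apply/matrixP => i j; rewrite !mxE.
by case: unlift => [l|]; rewrite ?mxE ?subr0.
Qed.

(** The entry at [k] is frozen, which is why [ones_hat] rather than [ones] enters the quadratic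
    bound. *)
Lemma eigenvec_part_in_cball d h l :
  in_cball d h -> `|eigenvec_part h l 0| <= (ones_hat k l 0 * d)%:C.
Proof.
move=> hd; rewrite !mxE; case: unliftP => [j|] ->.
  by rewrite eq_sym (negPf (neq_lift _ _)) mul1r.
by rewrite eqxx mul0r normr0 ler0c.
Qed.

(** The zero entry of [eigenvec_part h] at [k] compensates for the deleted column; entry [ord0] of
    [h] meets the column [- v]. *)
Lemma Df_mx_mul h :
  Df_mx *m h = (A - lam%:M) *m eigenvec_part h - h ord0 0 *: v.
Proof.
apply/matrixP => i j; rewrite ord1 !mxE big_ord_recl addrC; congr (_ + _).
  rewrite mulrC -mulrN; congr (_ * _).
  have -> : ord0 = lshift n 0 :> 'I_(1 + n) by apply: val_inj.
  by apply: etrans (row_mxEl _ _ _ _) _; rewrite mxE.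
rewrite (bigD1_ord k) //=.
have -> : eigenvec_part h k 0 = 0 by rewrite mxE unlift_none.
rewrite mulr0 add0r; apply: eq_bigr => l _.
rewrite [eigenvec_part _ _ _]mxE liftK; congr (_ * _).
have -> : lift ord0 l = rshift 1 l :> 'I_(1 + n) by apply: val_inj.
by apply: etrans (row_mxEr _ _ _ _) _; rewrite mxE.
Qed.

Lemma residual_eigenpair_shift h :
  let lv := eigenpair_shift h in
  A *m lv.2 - lv.1 *: lv.2 =
  (A *m v - lam *: v) + Df_mx *m h - h ord0 0 *: eigenvec_part h.
Proof.
rewrite /= Df_mx_mul mulmxBl mul_scalar_mx mulmxDr.
move: (A *m v) (A *m _) (eigenvec_part h) => Av Ae e.
by apply/matrixP => i j; rewrite !mxE; ring.
Qed.

Definition newton_map (Rm : 'M[R[i]]_n.+1) h : 'cV[R[i]]_n.+1 :=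
  let lv := eigenpair_shift h in h - Rm *m (A *m lv.2 - lv.1 *: lv.2).

Lemma newton_mapB Rm h g : newton_map Rm h - newton_map Rm g =
  (1%:M - Rm *m Df_mx) *m (h - g) +
  Rm *m (h ord0 0 *: eigenvec_part h - g ord0 0 *: eigenvec_part g).
Proof.
rewrite /newton_map !residual_eigenpair_shift mulmxBl mul1mx -mulmxA !mulmxBr.
rewrite !mulmxDr.
move: (Rm *m (Df_mx *m h)) (Rm *m (Df_mx *m g)) (Rm *m (_ *: eigenvec_part h))
  (Rm *m (_ *: eigenvec_part g)) (Rm *m (A *m v - lam *: v)) => a b c d e.
by apply/matrixP => i j; rewrite !mxE; ring.
Qed.

Lemma newton_map0 Rm : newton_map Rm 0 = - (Rm *m (A *m v - lam *: v)).
Proof.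
by rewrite /newton_map residual_eigenpair_shift mxE scale0r mulmx0 addr0 subr0
  sub0r.
Qed.

(** A fixed point makes [Rm] times the residual vanish; invertibility of [Rm] then removes the
    factor. *)
Lemma newton_map_fixpoint Rm h : Rm \in unitmx ->
  let lv := eigenpair_shift h in
  newton_map Rm h = h <-> A *m lv.2 = lv.1 *: lv.2.
Proof.
move=> Ru; rewrite /newton_map; split=> [Th|->]; last first.
  by rewrite subrr mulmx0 subr0.
apply/subr0_eq; rewrite -[LHS](mulKmx Ru).
suff -> : Rm *m (A *m (eigenpair_shift h).2 -
  (eigenpair_shift h).1 *: (eigenpair_shift h).2) = 0 by rewrite mulmx0.
by apply: oppr_inj; apply: (addrI h); rewrite Th oppr0 addr0.
Qed.

(** The product rule splits the difference into two terms, each at most [r * d] off the entry [k];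
    this is the 2 in [Z1bound]. *)
Lemma quadratic_part_lipschitz r d h g l : 0 <= d ->
  in_cball r h -> in_cball r g -> in_cball d (h - g) ->
  `|(h ord0 0 *: eigenvec_part h - g ord0 0 *: eigenvec_part g) l 0|
    <= ((2 *: ones_hat k) l 0 * (r * d))%:C.
Proof.
move=> d0 hr gr hg.
have -> : h ord0 0 *: eigenvec_part h - g ord0 0 *: eigenvec_part g =
    h ord0 0 *: eigenvec_part (h - g) + (h - g) ord0 0 *: eigenvec_part g.
  rewrite eigenvec_partB; move: (eigenvec_part _) (eigenvec_part _) => a b.
  by apply/matrixP => i j; rewrite !mxE; ring.
rewrite mxE; apply: le_trans (ler_normD _ _) _.
have -> : (2 *: ones_hat k : 'cV[R]_n.+1) l 0 * (r * d) =
    r * (ones_hat k l 0 * d) + d * (ones_hat k l 0 * r).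
  by rewrite [X in X * _]mxE; ring.
rewrite raddfD lerD //= mxE normrM rmorphM ler_pM //.
  exact: eigenvec_part_in_cball.
exact: eigenvec_part_in_cball.
Qed.

Lemma eigenpair_shift_in_cball r h : in_cball r h ->
  let lv := eigenpair_shift h in
  [/\ `|lv.1 - lam| <= r%:C,
      forall j, j != k -> `|lv.2 j 0 - v j 0| <= r%:C & lv.2 k 0 = v k 0].
Proof.
move=> hr; rewrite /eigenpair_shift /=; split.
- by rewrite addrAC subrr add0r.
- move=> j jk; rewrite [_ j 0]mxE addrAC subrr add0r.
  have := eigenvec_part_in_cball r h j hr.
  by rewrite [ones_hat k j 0]mxE (negPf jk) mul1r.
- by rewrite !mxE unlift_none addr0.
Qed.

(** Reduces uniqueness among eigenpairs to uniqueness among fixed points in the ball. *)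
Lemma eigenpair_shift_surj r (lv : R[i] * 'cV[R[i]]_n.+1) :
  `|lv.1 - lam| <= r%:C ->
  (forall j, j != k -> `|lv.2 j 0 - v j 0| <= r%:C) -> lv.2 k 0 = v k 0 ->
  exists2 h, in_cball r h & eigenpair_shift h = lv.
Proof.
case: lv => l w /= lr wr wk.
exists (\col_i
  if unlift ord0 i is Some j then (w - v) (lift k j) 0 else l - lam).
  move=> i; rewrite mxE; case: unlift => [j|//].
  by rewrite !mxE wr // eq_sym neq_lift.
congr (_, _); first by rewrite mxE unlift_none addrC subrK.
apply/matrixP => i j; rewrite ord1 !mxE; case: unliftP => [p ->|-> //].
  by rewrite !mxE liftK !mxE addrC subrK.
by rewrite addr0.
Qed.

End Eigenpair.

(** * Validity of the computed bounds for every [A] in [bA] *)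

Section Bounds.
Context {R : realType} (IA : interval_arith R) {n : nat}.
Variables (bA : 'M[citv R]_n.+1) (A : 'M[R[i]]_n.+1).
Variables (lam : R[i]) (v : 'cV[R[i]]_n.+1) (k : 'I_n.+1).
Variables (Rm : 'M[R[i]]_n.+1).
Hypothesis hA : mxmem A bA.

Lemma Ybound_ge j :
  `|(Rm *m (A *m v - lam *: v)) j 0| <= (Ybound IA bA lam v Rm j 0)%:C.
Proof.
rewrite -[leLHS]RRe_real ?normr_real // lecR [leRHS]mxE.
apply: rmem_le_rsup; rewrite [in X in rmem _ X]mxE.
apply/cabsP/mxmem_cmulmx; first exact: mxmem_cptmx.
apply: mxmem_csubmx.
  by apply: mxmem_cmulmx => //; exact: mxmem_cptmx.
by apply: mxmem_cscalemx; [exact: cmem_cpt | exact: mxmem_cptmx].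
Qed.

Lemma Z0bound_ge j :
  \sum_l complex.Re `|(1%:M - Rm *m Df_mx A lam v k) j l| * (ones n) l 0
    <= Z0bound IA bA lam v k Rm j 0.
Proof.
apply: le_trans (le_rmulmx_rptmx IA _ _ (\matrix_(i, l) complex.Re
  `|(1%:M - Rm *m Df_mx A lam v k) i l|) _ _ j _).
  by apply: ler_sum => l _; rewrite [X in _ <= X * _]mxE.
move=> i l; rewrite [in X in rmem X _]mxE [in X in rmem _ X]mxE.
apply/cabsP/mxmem_csubmx; first exact: mxmem_cptmx.
apply: mxmem_cmulmx; first exact: mxmem_cptmx.
(* The explicit width [1] reads the dimension [n.+1] as [1 + n]. *)
apply: (@mxmem_row_mx _ _ 1); first exact: mxmem_cptmx.
apply: (mxmem_col' _ n.+1); apply: mxmem_csubmx => //; exact: mxmem_cptmx.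
Qed.

(** The factor 2 moves from the matrix to the vector, to act as the weight in [le_mulmx_col]. *)
Lemma Z1bound_ge j :
  \sum_l complex.Re `|Rm j l| * (2 *: ones_hat k) l 0
    <= Z1bound IA k Rm j 0.
Proof.
apply: le_trans (le_rmulmx_rptmx IA _ _ (\matrix_(i, l) (2 * complex.Re
  `|Rm i l|)) _ _ j _).
  apply: ler_sum => l _; rewrite [X in _ <= X * _]mxE.
  by rewrite [X in _ * X <= _]mxE mulrCA mulrA.
move=> i l; rewrite [in X in rmem X _]mxE [in X in rmem _ X]mxE.
apply: rmulP; first exact: rmem_rpt.
by rewrite [in X in rmem _ X]mxE; apply/cabsP/mxmem_cptmx.
Qed.

End Bounds.

(** * Existence and uniqueness of the eigenpair from the radii polynomials *)

Theorem mainTheorem4 (R : realType) (IA : interval_arith R) (n : nat)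
    (bA : 'M[citv R]_n.+1)
    (lbar : R[i]) (vbar : 'cV[R[i]]_n.+1) (k : 'I_n.+1)
    (hk : forall j : 'I_n.+1, `|vbar j 0| <= `|vbar k 0|)
    (Rm : 'M[R[i]]_n.+1) (r : R) (hr : 0 < r)
    (hp : forall j : 'I_n.+1, radii_poly IA bA lbar vbar k Rm j r < 0)
    (A : 'M[R[i]]_n.+1) (hA : mxmem A bA) :
  exists! lv : R[i] * 'cV[R[i]]_n.+1,
    [/\ `|lv.1 - lbar| <= r%:C,
        forall j : 'I_n.+1, j != k -> `|lv.2 j 0 - vbar j 0| <= r%:C,
        lv.2 k 0 = vbar k 0
      & A *m lv.2 = lv.1 *: lv.2].
Proof.
pose Y j := Ybound IA bA lbar vbar Rm j 0.
pose Z0 j := Z0bound IA bA lbar vbar k Rm j 0.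
pose Z1 j := Z1bound IA k Rm j 0.
(* The contraction factor of component [j]: negativity of the radii polynomial reads
   [Y j + c j * r < r]. *)
pose c j := Z0 j + r * Z1 j.
have YA := Ybound_ge IA bA A lbar vbar Rm hA.
have Z0A := Z0bound_ge IA bA A lbar vbar k Rm hA.
have Z1A := Z1bound_ge IA k Rm.
(* An abstract interval arithmetic gives no sign directly; nonnegativity follows because the bounds
   dominate moduli. *)
have Y0 j : 0 <= Y j by rewrite -ler0c; apply: le_trans (YA j).
have Z10 j : 0 <= Z1 j.
  apply: le_trans (Z1A j); apply: sumr_ge0 => l _; apply: mulr_ge0.
    by rewrite -ler0c RRe_real ?normr_real.
  by rewrite !mxE; case: ifP; rewrite ?mulr0 ?mulr1.
have Yc j : Y j + c j * r < r.
  have := hp j; rewrite /radii_poly /Zbound !mxE subr_lt0.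
  by rewrite /Y /c /Z0 /Z1 !mxE; lra.
have c1 j : c j < 1.
  by rewrite -(ltr_pM2r hr) mul1r; have := Yc j; have := Y0 j; lra.
(* As [Z0 j <= c j < 1], the product of [Rm] with the Jacobian has trivial kernel, so both factors
   are invertible. *)
have Ru : Rm \in unitmx.
  suff : Rm *m Df_mx A lbar vbar k \in unitmx by rewrite unitmx_mul => /andP[].
  apply: ker0_unitmx; apply: (sub1_small_ker0 _ c c1) => j.
  by apply: le_trans (Z0A j) _; rewrite lerDl mulr_ge0 // ltW.
pose T := newton_map A lbar vbar k Rm.
have Tc h g d : in_cball r h -> in_cball r g -> in_cball d (h - g) ->
    forall j, `|(T h - T g) j 0| <= (c j * d)%:C.
  move=> hhr hgr hg j; have d0 : 0 <= d by apply: in_cball_ge0 hg.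
  rewrite newton_mapB mxE; apply: le_trans (ler_normD _ _) _.
  (* The two summands bound the linear and the quadratic part of [newton_mapB]. *)
  have -> : c j * d = Z0 j * d + Z1 j * (r * d) by rewrite /c; ring.
  rewrite [leRHS]raddfD lerD //.
    by apply: le_mulmx_col d0 (Z0A j) _ => l; rewrite [ones n l 0]mxE mul1r.
  apply: le_mulmx_col (Z1A j) _; first by rewrite mulr_ge0 // ltW.
  by move=> l; exact: quadratic_part_lipschitz.
have TY j : `|T 0 j 0| <= (Y j)%:C by rewrite /T newton_map0 mxE normrN.
have [h hhr Th] := radii_fixpoint c r T c1 Tc Y hr TY (fun j => ltW (Yc j)).
exists (eigenpair_shift lbar vbar k h); split.
  have [? ? ?] := eigenpair_shift_in_cball lbar vbar k r h hhr.
  by split => //; apply: (newton_map_fixpoint A lbar vbar k Rm h Ru).1.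
move=> lv [lvr wr wk eig].
have [g hgr glv] := eigenpair_shift_surj lbar vbar k r lv lvr wr wk.
rewrite -glv; congr eigenpair_shift.
apply: (componentwise_fixpoint_unique c r T c1 Tc) => //.
by apply: (newton_map_fixpoint A lbar vbar k Rm g Ru).2; rewrite glv.
Qed.
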